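(* Let $n$ be a positive integer, $k\in\{1,\dots,n\}$, and let $A,B\colon[0,1]^n\to[0,1]$ be standardized functions with $A\le B$. Suppose that at least one of the functions $A$ and $B$ satisfies Condition S and that $L_k^{(A,B)}(\mathbf R)\ge 0$ for all $\mathbf R\in\mathcal R_k([0,1]^n)$. Then the following are equivalent: (i) for all $\mathbf x\in[0,1]^n$: $P_{\mathrm M,k}^{(A,B)}(\mathbf x)\ge B(\mathbf x)-A(\mathbf x)$; (ii) for all $\mathbf x\in[0,1]^n$: $$A(\mathbf x)=\inf\{C(\mathbf x)\mid C\colon[0,1]^n\to[0,1],\ A\le C\le B,\ C\text{ is a $k$-increasing standardized function}\}.$$
   Context: Write $\mathbb I=[0,1]$; $\le$ between functions is the pointwise order, and ''increasing'' means non-decreasing. Boxes. For $\mathbf x,\mathbf y\in\mathbb I^n$, the product $R=[\mathbf x,\mathbf y]=\prod_{i=1}^n[x_i,y_i]$ is a $k$-box if $x_i<y_i$ for exactly $k$ indices $i$ and $x_i=y_i$ for the remaining $n-k$ indices. Its vertices are $\operatorname{ver}R=\prod_{i=1}^n\{x_i,y_i\}$. The sign of a vertex $\mathbf v$ is $\operatorname{sign}_R(\mathbf v)=(-1)^{m-(n-k)}$, where $m=|\{i: v_i=x_i\}|$. The multiplicity of $\mathbf u\in\mathbb I^n$ with respect to $R$ is $m_R(\mathbf u)=\operatorname{sign}_R(\mathbf u)$ if $\mathbf u\in\operatorname{ver}R$ and $0$ otherwise. $\mathcal R_k(\mathbb I^n)$ is the set of formal finite disjoint unions $\mathbf R=\bigsqcup_{j=1}^s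 R_j$ of $k$-boxes with vertices in $\mathbb I^n$, i.e. finite families (multisets) of $k$-boxes, where repetitions and overlaps are allowed; $m_{\mathbf R}(\mathbf u)=\sum_{j=1}^s m_{R_j}(\mathbf u)$. For functions $A\le B$ on $\mathbb I^n$, $$L_k^{(A,B)}(\mathbf R)=\sum_{\mathbf y:\,m_{\mathbf R}(\mathbf y)>0}m_{\mathbf R}(\mathbf y)B(\mathbf y)+\sum_{\mathbf y:\,m_{\mathbf R}(\mathbf y)<0}m_{\mathbf R}(\mathbf y)A(\mathbf y),\qquad P_{\mathrm M,k}^{(A,B)}(\mathbf x)=\inf_{\substack{\mathbf R\in\mathcal R_k(\mathbb I^n)\\ m_{\mathbf R}(\mathbf x)>0}}\frac{L_k^{(A,B)}(\mathbf R)}{|m_{\mathbf R}(\mathbf x)|},$$ with the convention that the infimum of the empty set in the definition of $P_{\mathrm M,k}^{(A,B)}$ equals $0$. Functions. $f\colon\mathbb I^n\to\mathbb I$ is $k$-increasing if $\sum_{\mathbf v\in\operatorname{ver}R}\operatorname{sign}_R(\mathbf v)f(\mathbf v)\ge0$ for every $k$-box $R$ in $\mathbb I^n$ ($1$-increasing means increasing in each variable); grounded if $f(\mathbf x)=0$ whenever some $x_i=0$; standardized if it is grounded, $1$-increasing and $f(1,\dots,1)=1$. Condition S. $f\colon\mathbb I^n\to\mathbb I$ satisfies Condition S if there is a countable set $S\subseteq\mathbb I$ such that for every $\mathbf u\in\mathbb I^n$ and every $i\in\{1,\dots,n\}$ the set of discontinuities of the section $t\mapsto f(u_1,\dots,u_{i-1},t,u_{i+1},\dots,u_n)$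 is contained in $S$. *)

(* Defs.v *)
From HB Require Import structures.
From mathcomp Require Import all_boot all_order all_algebra.
From mathcomp Require Import all_classical all_reals all_analysis.
Set Implicit Arguments.
Unset Strict Implicit.
Unset Printing Implicit Defensive.
Import Order.TTheory GRing.Theory Num.Theory.
Import numFieldNormedType.Exports.
Local Open Scope classical_set_scope.
Local Open Scope ring_scope.

(* A point of [0,1]^n is a row vector satisfying [cube].  A function
   [0,1]^n -> [0,1] is a total function on row vectors satisfying
   [unit_valued]; its values off the cube are never used. *)
Definition cube (R : realType) (n : nat) : set 'rV[R]_n :=
  [set x | forall i, 0 <= x ord0 i <= 1].

Definition unit_valued (R : realType) (n : nat) (f : 'rV[R]_n -> R) : Prop :=
  forall x, cube x -> 0 <= f x <= 1.

Definition le_on_cube (R : realType) (n : nat) (f g : 'rV[R]_n -> R) : Prop :=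
  forall x, cube x -> f x <= g x.

(* The pair (x, y) stands for the box [x, y]. *)
Notation box R n := ('rV[R]_n * 'rV[R]_n)%type.

Definition is_kbox (R : realType) (n k : nat) (b : box R n) : Prop :=
  [/\ cube b.1, cube b.2,
      (forall i, b.1 ord0 i <= b.2 ord0 i) &
      #|[set i : 'I_n | (b.1 ord0 i < b.2 ord0 i)%R]%SET| = k].

Definition ver (R : realType) (n : nat) (b : box R n) : set 'rV[R]_n :=
  [set v | forall i, v ord0 i = b.1 ord0 i \/ v ord0 i = b.2 ord0 i].

(* The truncated subtraction is harmless: a vertex of a k-box agrees with the
   lower corner at least on the n - k degenerate coordinates. *)
Definition box_sign (R : realType) (n k : nat) (b : box R n)
    (v : 'rV[R]_n) : int :=
  (-1) ^+ (#|[set i : 'I_n | v ord0 i == b.1 ord0 i]%SET| - (n - k))%N.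

Definition box_mult (R : realType) (n k : nat) (b : box R n)
    (u : 'rV[R]_n) : int :=
  if `[< ver b u >] then box_sign k b u else 0.

(* Families are lists: order is irrelevant to everything below, and
   repetitions count. *)
Definition kfamily (R : realType) (n k : nat) : set (seq (box R n)) :=
  [set F | forall b, b \in F -> is_kbox k b].

Definition mult (R : realType) (n k : nat) (F : seq (box R n))
    (u : 'rV[R]_n) : int :=
  \sum_(b <- F) box_mult k b u.

(* The index sets are finite, being made of vertices of the boxes in F. *)
Definition Lk (R : realType) (n k : nat) (A B : 'rV[R]_n -> R)
    (F : seq (box R n)) : R :=
  \sum_(y \in [set y | 0 < mult k F y]) (mult k F y)%:~R * B y +
  \sum_(y \in [set y | mult k F y < 0]) (mult k F y)%:~R * A y.

Definition PM (R : realType) (n k : nat) (A B : 'rV[R]_n -> R)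
    (x : 'rV[R]_n) : \bar R :=
  let E := [set (Lk k A B F / `|mult k F x|%:~R)%:E
           | F in [set F | kfamily k F /\ 0 < mult k F x]] in
  if `[< E = set0 >] then 0%E else ereal_inf E.

Definition k_increasing (R : realType) (n k : nat)
    (f : 'rV[R]_n -> R) : Prop :=
  forall b : box R n, is_kbox k b ->
    0 <= \sum_(v \in ver b) (box_sign k b v)%:~R * f v.

Definition grounded (R : realType) (n : nat) (f : 'rV[R]_n -> R) : Prop :=
  forall x, cube x -> (exists i, x ord0 i = 0) -> f x = 0.

Definition standardized (R : realType) (n : nat)
    (f : 'rV[R]_n -> R) : Prop :=
  [/\ unit_valued f, grounded f, k_increasing 1 f & f (const_mx 1) = 1].

Definition set_coord (R : realType) (n : nat) (u : 'rV[R]_n) (i : 'I_n)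
    (t : R) : 'rV[R]_n :=
  \row_j (if j == i then t else u ord0 j).

(* Continuity of sections is relative to [0,1], so one-sided at 0 and 1. *)
Definition section_discontinuities (R : realType) (n : nat)
    (f : 'rV[R]_n -> R) (u : 'rV[R]_n) (i : 'I_n) : set R :=
  [set t : R | 0 <= t <= 1 /\
     ~ (f (set_coord u i s) @[s --> within `[0, 1] (nbhs t)]
          --> f (set_coord u i t))].

Definition condition_S (R : realType) (n : nat) (f : 'rV[R]_n -> R) : Prop :=
  exists S : set R, [/\ countable S, S `<=` `[0, 1] &
    forall u, cube u -> forall i, section_discontinuities f u i `<=` S].

(* Main.v *)
(* For integer weights m with finite support, the supremum of
   [\sum_y m y * C y] over all C with A <= C <= B is [max_sum A B m], and for
   the multiplicity function of a family F it equals [Lk k A B F].  The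
   hypothesis that these suprema are nonnegative on a set of weights closed
   under addition is inherited when the interval [A x, B x] at a single point x
   is shrunk to a suitable one-point interval; by Zorn's lemma all intervals
   can be shrunk simultaneously, which yields a k-increasing C between A and B.

   Condition (i) says exactly that the hypothesis on Lk survives when B x is
   lowered to A x, so it produces a k-increasing C with C x = A x; hence the
   infimum in (ii) is attained.  Conversely, a k-increasing C between A and B
   gives 0 <= \sum_y m y * C y <= Lk k A B F - m x * (B x - C x), and the
   infimum over C yields (i).  When no family has positive multiplicity at x,
   some coordinate of x is 0 and A x = B x = 0. *)

Require Import Defs.
From HB Require Import structures.
From mathcomp Require Import all_boot all_order all_algebra.
From mathcomp Require Import all_classical all_reals all_analysis.
Set Implicit Arguments.
Unset Strict Implicit.
Unset Printing Implicit Defensive.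
Import Order.TTheory GRing.Theory Num.Theory.
Import numFieldNormedType.Exports.
Local Open Scope classical_set_scope.
Local Open Scope ring_scope.

(** * Maximal integer-weighted sums over an order interval of functions *)

Definition max_val (R : realType) (l h : R) (a : int) : R :=
  Num.max (a%:~R * l) (a%:~R * h).

Lemma max_valD (R : realType) (l h : R) (a b : int) :
  max_val l h (a + b) <= max_val l h a + max_val l h b.
Proof.
by rewrite /max_val rmorphD /= !mulrDl ge_max !lerD ?le_max ?lexx ?orbT.
Qed.

Lemma max_valMn (R : realType) (l h : R) (a : int) (j : nat) :
  max_val l h (a *+ j) = max_val l h a *+ j.
Proof.
rewrite /max_val -(mulr_natr (Num.max _ _)) maxr_pMl ?ler0n// rmorphMn /=.
by rewrite !mulrnAl !mulr_natr.
Qed.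

Lemma max_val0 (R : realType) (l h : R) : max_val l h 0 = 0.
Proof. by rewrite /max_val !mul0r maxxx. Qed.

Lemma max_val_cst (R : realType) (c : R) (a : int) : max_val c c a = a%:~R * c.
Proof. by rewrite /max_val maxxx. Qed.

Lemma max_val_ge (R : realType) (l c h : R) (a : int) :
  l <= c <= h -> a%:~R * c <= max_val l h a.
Proof.
move=> /andP[lc ch]; rewrite /max_val le_max.
have [a0|a0] := leP 0 a; first by rewrite (ler_wpM2l _ ch) ?orbT ?ler0z.
by rewrite (ler_wnM2l _ lc)// lerz0 ltW.
Qed.

Lemma max_valE (R : realType) (l h : R) (a : int) : l <= h ->
  max_val l h a = if 0 < a then a%:~R * h else a%:~R * l.
Proof.
move=> lh; rewrite /max_val; case: ltP => a0.
  by apply/max_idPr; rewrite ler_wpM2l// ler0z ltW.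
by apply/max_idPl; rewrite ler_wnM2l// lerz0.
Qed.

Definition finitely_supported (T : choiceType) (m : T -> int) : Prop :=
  exists s : seq T, forall y, m y != 0 -> y \in s.

(* The largest value of [\sum_y m y * C y] over all C between l and h. *)
Definition max_sum (R : realType) (T : choiceType) (l h : T -> R)
    (m : T -> int) : R :=
  \sum_(y \in [set: T]) max_val (l y) (h y) (m y).

Lemma max_sumE (R : realType) (T : choiceType) (l h : T -> R) (m : T -> int)
    (s : seq T) : uniq s -> (forall y, m y != 0 -> y \in s) ->
  max_sum l h m = \sum_(y <- s) max_val (l y) (h y) (m y).
Proof.
move=> us ms; rewrite /max_sum (fsbigE s)//.
  by apply: eq_bigl => y; rewrite in_setT.
move=> y _ ys; suff /eqP -> : m y == 0 by rewrite max_val0.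
by apply: contraNT ys; exact: ms.
Qed.

Lemma max_sumD (R : realType) (T : choiceType) (l h : T -> R)
    (m m' : T -> int) : finitely_supported m -> finitely_supported m' ->
  max_sum l h (m \+ m') <= max_sum l h m + max_sum l h m'.
Proof.
move=> [s ms] [s' ms']; have us := undup_uniq (s ++ s').
have sE y : (y \in undup (s ++ s')) = (y \in s) || (y \in s').
  by rewrite mem_undup mem_cat.
rewrite !(max_sumE l h us).
- rewrite -big_split /=; apply: ler_sum => y _; exact: max_valD.
- by move=> y /ms'; rewrite sE orbC => ->.
- by move=> y /ms; rewrite sE => ->.
- move=> y /=; rewrite sE; have [/eqP m0|/ms -> //] := eqVneq (m y) 0.
  by rewrite (eqP m0) add0r => /ms' ->; rewrite orbT.
Qed.

Lemma max_sumMn (R : realType) (T : choiceType) (l h : T -> R)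
    (m : T -> int) (j : nat) : finitely_supported m ->
  max_sum l h (fun y => m y *+ j) = max_sum l h m *+ j.
Proof.
move=> [s ms]; have us := undup_uniq s.
rewrite !(max_sumE l h us).
- by rewrite -sumrMnl; apply: eq_bigr => y _; exact: max_valMn.
- by move=> y /ms; rewrite mem_undup.
- move=> y; rewrite mem_undup; have [->|/ms //] := eqVneq (m y) 0.
  by rewrite mul0rn eqxx.
Qed.

(** Isolates the contribution of [x]: since [max_val 0 0] vanishes identically, the second summand
    is the sum over the points other than [x], whatever [a] and [b] are. *)
Lemma max_sum_update (R : realType) (T : choiceType) (l h : T -> R) (x : T)
    (a b : R) (m : T -> int) : finitely_supported m ->
  max_sum [eta l with x |-> a] [eta h with x |-> b] m =
  max_val a b (m x) + max_sum [eta l with x |-> 0] [eta h with x |-> 0] m.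
Proof.
move=> [s ms]; have us : uniq (x :: rem x (undup s)).
  by rewrite /= rem_uniq ?undup_uniq// mem_rem_uniq ?undup_uniq// inE eqxx.
have ms' y : m y != 0 -> y \in x :: rem x (undup s).
  move=> /ms ys; rewrite inE mem_rem_uniq ?undup_uniq// inE mem_undup ys andbT.
  by rewrite orbN.
rewrite !(max_sumE _ _ us ms') !big_cons /= eqxx max_val_cst mulr0 add0r.
congr +%R; apply: eq_big_seq => y yr; case: eqVneq => [yx|//].
by move: yr us; rewrite yx /= => ->.
Qed.

Lemma update_self (T : eqType) (R : Type) (g : T -> R) (x : T) :
  [eta g with x |-> g x] = g :> (T -> R).
Proof. by apply/funext => y /=; case: eqVneq => [->|]. Qed.

Lemma finitely_supportedD (T : choiceType) (m m' : T -> int) :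
  finitely_supported m -> finitely_supported m' ->
  finitely_supported (m \+ m').
Proof.
move=> [s ms] [s' ms']; exists (s ++ s') => y /=; rewrite mem_cat.
have [->|/ms -> //] := eqVneq (m y) 0.
by rewrite add0r => /ms' ->; rewrite orbT.
Qed.

Lemma finitely_supportedMn (T : choiceType) (m : T -> int) (j : nat) :
  finitely_supported m -> finitely_supported (fun y => m y *+ j).
Proof.
move=> [s ms]; exists s => y; have [->|/ms //] := eqVneq (m y) 0.
by rewrite mul0rn eqxx.
Qed.

(** * A sandwich theorem for additively closed sets of integer weights *)

Section Sandwich.
Variables (R : realType) (T : choiceType) (M : set (T -> int)).
Hypothesis M_fin : forall m, M m -> finitely_supported m.
Hypothesis M0 : M (fun=> 0).
Hypothesis MD : forall m m', M m -> M m' -> M (m \+ m').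

Let MMn m j : M m -> M (fun y => m y *+ j).
Proof.
move=> Mm; elim: j => [|j IHj]; first by under eq_fun do rewrite mulr0n.
by under eq_fun do rewrite mulrS; exact: MD.
Qed.

(* Any c above all [- W m / m x] (m x > 0) and below all [W m / - m x]
   (m x < 0) works, where W is the contribution of the points other than x.
   Every lower bound is at most every upper bound because of the member
   [|m' x| m + |m x| m'] of M, which vanishes at x. *)
Lemma determine_value (l h : T -> R) (x : T) : l x <= h x ->
  (forall m, M m -> 0 <= max_sum l h m) ->
  exists2 c, l x <= c <= h x &
    forall m, M m -> 0 <= max_sum [eta l with x |-> c] [eta h with x |-> c] m.
Proof.
move=> lhx L0.
pose W := max_sum [eta l with x |-> 0] [eta h with x |-> 0].
have LE m : M m -> max_sum l h m = max_val (l x) (h x) (m x) + W m.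
  by move=> /M_fin mf; rewrite /W -max_sum_update// !update_self.
(* The lower bounds on [c]. Including [l x] makes [E] nonempty and gives [l x <= sup E]. *)
pose E := [set c | c = l x \/
  exists m, [/\ M m, 0 < m x & c = - W m / (m x)%:~R]].
have Elx : E (l x) by left.
have Eh : ubound E (h x).
  move=> _ [->//|[m [Mm mx ->]]].
  have mxR : 0 < (m x)%:~R :> R by rewrite ltr0z.
  rewrite ler_pdivrMr// -subr_ge0 opprK mulrC.
  by have := L0 m Mm; rewrite LE// max_valE// mx.
have Em m : M m -> m x < 0 -> ubound E (W m / - (m x)%:~R).
  move=> Mm mx; have mxR : 0 < - (m x)%:~R :> R by rewrite oppr_gt0 ltrz0.
  move=> _ [->|[m' [Mm' m'x ->]]]; rewrite ler_pdivlMr//.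
    rewrite -subr_ge0 mulrN opprK addrC mulrC.
    by have := L0 m Mm; rewrite LE// max_valE// ltNge (ltW mx).
  have m'xR : 0 < (m' x)%:~R :> R by rewrite ltr0z.
  rewrite mulrAC ler_pdivrMr//.
  pose m2 y := m y *+ `|m' x|%N + m' y *+ `|m x|%N.
  have Mm2 : M m2 by apply: MD; exact: MMn.
  have m2x : m2 x = 0.
    by rewrite /m2 -(mulr_natr (m x)) -(mulr_natr (m' x)) !natz gtz0_abs//
      ltz0_abs// mulrN mulrC subrr.
  have W2 : W m2 <= W m *+ `|m' x|%N + W m' *+ `|m x|%N.
    rewrite /W -!max_sumMn; try exact: M_fin.
    by apply: max_sumD; apply: finitely_supportedMn; exact: M_fin.
  have := L0 _ Mm2; rewrite LE// m2x max_val0 add0r => /le_trans /(_ W2).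
  have absR (z : int) : `|z|%N%:R = `|z%:~R| :> R.
    by rewrite -intr_norm -[in RHS]abszE pmulrn.
  rewrite -(mulr_natr (W m)) -(mulr_natr (W m')) !absR.
  rewrite (gtr0_norm m'xR) ltr0_norm ?ltrz0//.
  by move=> ?; rewrite -subr_ge0 mulNr opprK.
have E0 : E !=set0 by exists (l x).
have hE : has_ubound E by exists (h x).
exists (sup E); first by rewrite ub_le_sup//= ge_sup.
move=> m Mm; rewrite max_sum_update; last exact: M_fin.
rewrite max_val_cst -/(W m).
have [mx|mx|mx] := ltgtP (m x) 0.
- have mxR : 0 < - (m x)%:~R :> R by rewrite oppr_gt0 ltrz0.
  have := ge_sup E0 (Em m Mm mx).
  by rewrite ler_pdivlMr// -subr_ge0 mulrN opprK addrC mulrC.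
- have mxR : 0 < (m x)%:~R :> R by rewrite ltr0z.
  have : - W m / (m x)%:~R <= sup E by apply: ub_le_sup => //; right; exists m.
  by rewrite ler_pdivrMr// -subr_ge0 opprK mulrC.
- by have := L0 m Mm; rewrite LE// mx max_val0 mul0r.
Qed.

Let fill (l : T -> R) (p : T -> option R) y := odflt (l y) (p y).

(* Zorn's lemma on partial functions p such that the condition survives when
   l and h are both replaced by p on the domain of p. *)
Lemma sandwich (l h : T -> R) : (forall y, l y <= h y) ->
  (forall m, M m -> 0 <= max_sum l h m) ->
  exists2 C : T -> R, forall y, l y <= C y <= h y &
    forall m, M m -> 0 <= max_sum C C m.
Proof.
move=> lh L0.
pose good (p : T -> option R) :=
  (forall y c, p y = Some c -> l y <= c <= h y) /\
  forall m, M m -> 0 <= max_sum (fill l p) (fill h p) m.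
pose ext (p q : {p | good p}) : bool :=
  `[< forall y c, sval p y = Some c -> sval q y = Some c >].
have good0 : good (fun=> None) by split.
have ext_refl p : ext p p by apply/asboolP.
have ext_trans p q r : ext p q -> ext q r -> ext p r.
  move=> /asboolP pq /asboolP qr; apply/asboolP => y c /pq; exact: qr.
have ext_anti p q : ext p q -> ext q p -> p = q.
  case: p q => [p gp] [q gq] /asboolP/= pq /asboolP/= qp.
  apply: eq_exist; apply/funext => y.
  case Ep: (p y) => [c|]; first by rewrite (pq _ _ Ep).
  by case Eq: (q y) => [c|//]; rewrite (qp _ _ Eq) in Ep.
have ext_chain (Z : set {p | good p}) : total_on Z (fun p q => ext p q) ->
    exists q, forall p, Z p -> ext p q.
  move=> Ztot; have [->|/set0P[p0 Zp0]] := eqVneq Z set0.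
    by exists (exist _ _ good0).
  (* A nonempty chain is bounded by the union [q] of its graphs; comparability of any two members
     makes the union single-valued ([hitP]). *)
  pose hit y c := exists2 p, Z p & sval p y = Some c.
  pose q y := if pselect (exists c, hit y c) is left e
              then Some (sval (cid e)) else None.
  have hitP y c : hit y c -> q y = Some c.
    move=> [p Zp pc]; rewrite /q; case: pselect => [e|[]]; last by exists c, p.
    case: cid => d [p' Zp' p'd] /=.
    by case: (Ztot _ _ Zp Zp') => /asboolP pp';
      [have := pp' _ _ pc; rewrite p'd | have := pp' _ _ p'd; rewrite pc].
  have qhit y c : q y = Some c -> hit y c.
    by rewrite /q; case: pselect => // e [<-]; exact: svalP.
  (* On finitely many points a single member of the chain already coincides with [q]. As every
     weight has finite support, [q] inherits the inequality from such a member. *)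
  have agree (s : seq T) : exists2 p, Z p & {in s, sval p =1 q}.
    elim: s => [|y s [p Zp ps]]; first by exists p0.
    have [p' [Zp' pp' p'y]] :
        exists p', [/\ Z p', ext p p' & sval p' y = q y].
      case Eq: (q y) => [c|]; last first.
        exists p; split => //; case Ep: (sval p y) => [c|//].
        by rewrite -Eq (@hitP y c)//; exists p.
      have [p' Zp' p'c] := qhit _ _ Eq.
      case: (Ztot _ _ Zp Zp') => pp'; first by exists p'.
      by exists p; split => //; move/asboolP: pp'; exact.
    exists p' => // z; rewrite inE => /predU1P[->//|zs].
    case Ep: (sval p z) => [c|].
      by rewrite -ps// Ep; move/asboolP: pp' => /(_ _ _ Ep).
    rewrite -ps// Ep; case Ep': (sval p' z) => [c|//].
    by have := hitP z c; rewrite -ps// Ep => ->//; exists p'.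
  have gq : good q.
    split=> [y c /qhit[p Zp]|m Mm]; first by case: p Zp => p [/= + _] _; exact.
    have [s ms] := M_fin Mm; have us := undup_uniq s.
    have ms' y : m y != 0 -> y \in undup s by move=> /ms; rewrite mem_undup.
    have [[p [pb pL]] Zp /= pq] := agree (undup s).
    have := pL m Mm; rewrite !(max_sumE _ _ us ms').
    by under eq_big_seq => y ys do rewrite /fill pq//.
  exists (exist _ q gq) => p Zp; apply/asboolP => y c pc /=.
  by apply: hitP; exists p.
have [[p gp] pmax] := Zorn ext_refl ext_trans ext_anti ext_chain.
have [pb pL] := gp.
(* A maximal [p] is total: at an undefined point, [determine_value] applied to the filled bounds
   would give a proper extension. *)
have pT y : exists c, p y = Some c.
  case Ep: (p y) => [c|]; first by exists c.
  have lhy : fill l p y <= fill h p y by rewrite /fill Ep lh.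
  have [c lch cL] := determine_value lhy pL.
  pose q : T -> option R := [eta p with y |-> Some c].
  have qE g : fill g q = [eta fill g p with y |-> c].
    by apply/funext => z; rewrite /fill /q /=; case: ifP.
  have gq : good q.
    split=> [z d|m Mm]; last by rewrite !qE; exact: cL.
    rewrite /q /=; case: eqVneq => [-> [<-]|_]; last exact: pb.
    by move: lch; rewrite /fill Ep.
  have pq : ext (exist _ p gp) (exist _ q gq).
    by apply/asboolP => z d; rewrite /q /=; case: eqVneq => [->|//]; rewrite Ep.
  by have := congr1 (fun r => sval r y) (pmax _ pq); rewrite /q /= eqxx Ep.
have fillE g : fill g p = fill l p.
  by apply/funext => y; rewrite /fill; have [c ->] := pT y.
exists (fill l p) => [y|m Mm].
  by rewrite /fill; have [c pc] := pT y; rewrite pc; exact: pb.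
by have := pL m Mm; rewrite (fillE h).
Qed.

End Sandwich.

(** * Sums for a fixed function: additivity and comparison *)

Lemma max_sum_cstD (R : realType) (T : choiceType) (f : T -> R)
    (m m' : T -> int) : finitely_supported m -> finitely_supported m' ->
  max_sum f f (m \+ m') = max_sum f f m + max_sum f f m'.
Proof.
move=> mf mf'; have [s ms] := finitely_supportedD mf mf'.
(* One list containing all three supports, so that the three sums run over the same index list. The
   support of the sum alone may miss points where [m] and [m'] cancel. *)
have {ms mf mf'} [s' [us ms ms' mms]] : exists s' : seq T, [/\ uniq s',
    forall y, m y != 0 -> y \in s', forall y, m' y != 0 -> y \in s' &
    forall y, (m \+ m') y != 0 -> y \in s'].
  move: mf mf' => [s1 ms1] [s2 ms2]; exists (undup (s ++ s1 ++ s2)).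
  by split=> [|y /ms1|y /ms2|y /ms]; rewrite ?undup_uniq// mem_undup !mem_cat;
    move=> ->; rewrite ?orbT.
rewrite !(max_sumE _ _ us)// -big_split /=; apply: eq_bigr => y _.
by rewrite !max_val_cst rmorphD /= mulrDl.
Qed.

Lemma max_sum_cst_le (R : realType) (T : choiceType) (l c h : T -> R)
    (m : T -> int) : finitely_supported m ->
  (forall y, m y != 0 -> l y <= c y <= h y) ->
  max_sum c c m <= max_sum l h m.
Proof.
move=> [s ms] lch; have us := undup_uniq s.
have ms' y : m y != 0 -> y \in undup s by move=> /ms; rewrite mem_undup.
rewrite !(max_sumE _ _ us ms'); apply: ler_sum => y _; rewrite max_val_cst.
have [->|m0] := eqVneq (m y) 0; first by rewrite max_val0 mul0r.
exact/max_val_ge/lch.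
Qed.

Lemma eq_max_sum (R : realType) (T : choiceType) (l h h' : T -> R)
    (m : T -> int) : (forall y, m y != 0 -> h y = h' y) ->
  max_sum l h m = max_sum l h' m.
Proof.
move=> hh'; apply: eq_fsbigr => y _.
by have [->|/hh' ->//] := eqVneq (m y) 0; rewrite !max_val0.
Qed.

(** * Boxes, multiplicity functions and [Lk] as a maximal sum *)

Lemma finite_ver (R : realType) (n : nat) (b : box R n) : finite_set (ver b).
Proof.
pose f (c : {ffun 'I_n -> bool}) : 'rV[R]_n :=
  \row_i (if c i then b.1 ord0 i else b.2 ord0 i).
apply: (@sub_finite_set _ _ (f @` setT)); last exact/finite_image/finite_finset.
move=> v bv; exists [ffun i => v ord0 i == b.1 ord0 i] => //.
apply/rowP => i; rewrite mxE ffunE; case: eqVneq => [->//|].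
by case: (bv i) => -> //; rewrite eqxx.
Qed.

Lemma ver_cube (R : realType) (n k : nat) (b : box R n) :
  is_kbox k b -> ver b `<=` @cube R n.
Proof.
by move=> [b1 b2 _ _] v bv i; case: (bv i) => ->; [exact: b1 | exact: b2].
Qed.

Lemma box_mult_finite (R : realType) (n k : nat) (b : box R n) :
  finitely_supported (box_mult k b).
Proof.
exists (finmap.enum_fset (fset_set (ver b))) => y; rewrite /box_mult.
case: asboolP => [by_ _|]; last by rewrite eqxx.
by rewrite in_fset_set ?inE//; exact: finite_ver.
Qed.

Lemma mult_nil (R : realType) (n k : nat) :
  mult k [::] = (fun=> 0) :> ('rV[R]_n -> int).
Proof. by apply/funext => y; rewrite /mult big_nil. Qed.

Lemma mult_cons (R : realType) (n k : nat) (b : box R n) (F : seq (box R n)) :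
  mult k (b :: F) = box_mult k b \+ mult k F.
Proof. by apply/funext => y; rewrite /mult big_cons. Qed.

Lemma mult_cat (R : realType) (n k : nat) (F G : seq (box R n)) :
  mult k (F ++ G) = mult k F \+ mult k G.
Proof. by apply/funext => y; rewrite /mult big_cat. Qed.

Lemma mult_seq1 (R : realType) (n k : nat) (b : box R n) :
  mult k [:: b] = box_mult k b.
Proof. by apply/funext => y; rewrite /mult big_seq1. Qed.

Lemma mult_finite (R : realType) (n k : nat) (F : seq (box R n)) :
  finitely_supported (mult k F).
Proof.
elim: F => [|b F IHF].
  by rewrite mult_nil; exists [::] => y; rewrite eqxx.
by rewrite mult_cons; apply: finitely_supportedD => //; exact: box_mult_finite.
Qed.

Lemma mult_cube (R : realType) (n k : nat) (F : seq (box R n)) (y : 'rV[R]_n) :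
  kfamily k F -> mult k F y != 0 -> cube y.
Proof.
move=> kF; have [//|Ny] := pselect (cube y).
rewrite /mult big_seq big1 ?eqxx// => b /kF kb.
by rewrite /box_mult asboolF// => /(ver_cube kb).
Qed.

Lemma box_sumE (R : realType) (n k : nat) (f : 'rV[R]_n -> R) (b : box R n) :
  \sum_(v \in ver b) (box_sign k b v)%:~R * f v = max_sum f f (box_mult k b).
Proof.
rewrite /max_sum -(@fsbig_widen _ _ _ _ (ver b) setT)//.
  apply: eq_fsbigr => v; rewrite inE => bv.
  by rewrite max_val_cst /box_mult asboolT.
by move=> v [_ Nbv] /=; rewrite /box_mult asboolF// max_val0.
Qed.

Lemma k_increasing_mult (R : realType) (n k : nat) (f : 'rV[R]_n -> R)
    (F : seq (box R n)) : k_increasing k f -> kfamily k F ->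
  0 <= max_sum f f (mult k F).
Proof.
move=> kf; elim: F => [|b F IHF] kF.
  by rewrite mult_nil /max_sum fsbig1// => y _; exact: max_val0.
rewrite mult_cons max_sum_cstD; [|exact: box_mult_finite|exact: mult_finite].
rewrite addr_ge0//; last first.
  by apply: IHF => b' b'F; apply: kF; rewrite inE b'F orbT.
by rewrite -box_sumE; apply: kf; apply: kF; rewrite inE eqxx.
Qed.

Lemma fsum_seq (R : realType) (T : choiceType) (P : set T) (f : T -> R)
    (s : seq T) : uniq s -> (forall y, P y -> y \in s) ->
  \sum_(y \in P) f y = \sum_(y <- s) (if y \in P then f y else 0).
Proof.
move=> us Ps; rewrite -big_mkcond -big_filter [RHS]fsbig_seq ?filter_uniq//.
apply: eq_fsbigl; apply/seteqP; split=> y /=; rewrite mem_filter.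
  by move=> Py; rewrite Ps// andbT; exact/mem_set.
by case/andP => /set_mem.
Qed.

(** The maximum is attained at [B] for positive weights and at [A] for negative ones; the support of
    the multiplicity function lies in the cube, where [A <= B]. *)
Lemma LkE (R : realType) (n k : nat) (A B : 'rV[R]_n -> R)
    (F : seq (box R n)) : le_on_cube A B -> kfamily k F ->
  Lk k A B F = max_sum A B (mult k F).
Proof.
move=> AB kF; have [s ms] := mult_finite k F; have us := undup_uniq s.
have ms' y : mult k F y != 0 -> y \in undup s by move=> /ms; rewrite mem_undup.
rewrite (max_sumE _ _ us ms') /Lk !(fsum_seq _ us).
- rewrite -big_split /=; apply: eq_bigr => y _.
  have setE (P : pred 'rV[R]_n) : (y \in [set z | P z]) = P y.
    exact: asboolb.
  rewrite !setE.
  have [->|m0] := eqVneq (mult k F y) 0.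
    by rewrite max_val0 !mul0r !ltxx addr0.
  rewrite max_valE; last exact/AB/(mult_cube kF).
  by case: ltgtP m0 => //= _ _; rewrite ?addr0 ?add0r.
- by move=> y /= /lt_eqF m0; apply: ms'; rewrite m0.
- by move=> y /= /gt_eqF m0; apply: ms'; rewrite m0.
Qed.

(** An application of [sandwich] to the multiplicity functions of k-families, which are closed under
    addition because families can be concatenated. The conclusion for one-box families is
    k-monotonicity. *)
Lemma k_increasing_between (R : realType) (n k : nat) (A B : 'rV[R]_n -> R) :
  le_on_cube A B ->
  (forall F : seq (box R n), kfamily k F -> 0 <= max_sum A B (mult k F)) ->
  exists C, [/\ le_on_cube A C, le_on_cube C B & k_increasing k C].
Proof.
(* [sandwich] asks for ordered bounds at every row vector, while [AB] speaks of the cube only; [h]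
   is ordered above [A] everywhere and equals [B] on the cube. *)
move=> AB L0; pose h y := Num.max (A y) (B y).
have hE y : cube y -> h y = B y by move=> /AB /max_idPr.
pose M := [set m | exists2 F : seq (box R n), kfamily k F & m = mult k F].
have [_ [F _ ->]|||y|_ [F kF ->]|C ACh CM] := @sandwich R _ M _ _ _ A h.
- exact: mult_finite.
- by exists [::]; [move=> b | rewrite mult_nil].
- move=> _ _ [F kF ->] [G kG ->]; exists (F ++ G); last by rewrite mult_cat.
  by move=> b; rewrite mem_cat => /orP[/kF|/kG].
- by rewrite /h le_max lexx.
- by rewrite (@eq_max_sum _ _ _ _ B) ?L0// => y /(mult_cube kF) /hE.
exists C; split=> [y _|y yc|b kb].
- by have /andP[] := ACh y.
- by rewrite -(hE y yc); have /andP[] := ACh y.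
- rewrite box_sumE -mult_seq1; apply: CM; exists [:: b] => // b'.
  by rewrite inE => /eqP ->.
Qed.

(** * Grounded k-increasing functions and standardization *)

Lemma exists_subset (T : finType) (A : {set T}) (j : nat) : (j <= #|A|)%N ->
  exists2 J : {set T}, J \subset A & #|J| = j.
Proof.
move=> /card_geqP[s [us <- sA]]; exists [set x in s]%SET.
  by apply/fintype.subsetP => x; rewrite inE => /sA.
by rewrite cardsE; apply/card_uniqP.
Qed.

(* A one-dimensional box has the same alternating sum as the k-box obtained by
   lowering k - 1 of its degenerate coordinates to 0, since f vanishes at the
   new vertices. *)
Lemma grounded_k_increasing1 (R : realType) (n k : nat) (f : 'rV[R]_n -> R) :
  (1 <= k <= n)%N -> grounded f -> k_increasing k f -> k_increasing 1 f.
Proof.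
move=> /andP[k1 kn] f0 fk b kb; have [b1c b2c b12 D1] := kb.
pose D := [set i | b.1 ord0 i < b.2 ord0 i]%SET.
(* If a degenerate coordinate of [b] is 0, all its vertices share this 0 and every term vanishes. *)
have [[i [iD bi]]|pos] := pselect (exists i, i \notin D /\ b.1 ord0 i = 0).
  rewrite fsbig1// => v bv; rewrite f0 ?mulr0//; first exact: (ver_cube kb).
  exists i; have := b12 i; move: iD; rewrite inE -leNgt => b21 b12i.
  have /eqP b1E : b.1 ord0 i == b.2 ord0 i by rewrite eq_le b12i.
  by case: (bv i) => ->; rewrite -?b1E.
(* [D] is a singleton, so its complement has [n - 1 >= k - 1] elements. *)
have [J JD Jk] : exists2 J : {set 'I_n}, J \subset ~: D & #|J| = k.-1.
  apply: exists_subset.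
  by rewrite cardsCs finset.setCK D1 card_ord -subn1 leq_sub2r.
have JD' i : i \in J -> 0 < b.1 ord0 i /\ b.1 ord0 i = b.2 ord0 i.
  move=> /(fintype.subsetP JD); rewrite inE => iD; split.
    rewrite lt_neqAle; have /andP[-> _] := b1c i; rewrite andbT eq_sym.
    by apply/eqP => bi; apply: pos; exists i.
  by apply/eqP; rewrite eq_le b12 leNgt; move: iD; rewrite inE.
pose b' : box R n := (\row_i (if i \in J then 0 else b.1 ord0 i), b.2).
have kb' : is_kbox k b'.
  split=> //= [i|i|].
  - by rewrite mxE; case: ifP => // _; rewrite lexx ler01.
  - by rewrite mxE; case: ifP => // _; have /andP[] := b2c i.
  - have -> : [set i | b'.1 ord0 i < b'.2 ord0 i]%SET = D :|: J.
      apply/finset.setP => i; rewrite !inE mxE.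
      case: ifPn => iJ; last by rewrite orbF.
      by have [+ <-] := JD' i iJ; rewrite orbT.
    rewrite cardsU D1 Jk; have -> : D :&: J = finset.set0.
      by apply/eqP; rewrite setI_eq0 disjoint_sym finset.disjoints_subset.
    by rewrite cards0 subn0 add1n prednK.
have vb v : ver b v -> ver b' v.
  move=> bv i; rewrite /= mxE; case: ifP => // iJ; right.
  by have [_ <-] := JD' i iJ; case: (bv i) => -> //; have [_ <-] := JD' i iJ.
have := fk b' kb'; rewrite -(@fsbig_widen _ _ _ _ (ver b) (ver b'))//.
  congr (0 <= _); apply: eq_fsbigr => v; rewrite inE => bv; congr (_%:~R * _).
  (* Passing to [b'] removes the [k - 1] coordinates of [J] from those where [v] meets the lower
     corner; since [(k - 1) + (n - k) = n - 1], both exponents agree. *)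
  rewrite /box_sign; congr (_ ^+ _).
  have -> : [set i | v ord0 i == b'.1 ord0 i]%SET =
            [set i | v ord0 i == b.1 ord0 i]%SET :\: J.
    apply/finset.setP => i; rewrite !inE mxE; case: ifPn => //= iJ.
    have [b1i b12i] := JD' i iJ; apply/negbTE; rewrite gt_eqF//.
    by case: (bv i) => ->; rewrite -?b12i.
  rewrite cardsDS; first by rewrite Jk -subnDA -subn1 addnC addnBA// subnK.
  apply/fintype.subsetP => i iJ; rewrite inE.
  by case: (bv i) => ->//; have [_ <-] := JD' i iJ.
move=> v [b'v Nbv] /=; rewrite f0 ?mulr0//; first exact: (ver_cube kb').
apply: contrapT => v0; apply: Nbv => i; have := b'v i.
rewrite /= mxE; case: ifP => // _ [vi|]; last by right.
by exfalso; apply: v0; exists i.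
Qed.

(** The range, groundedness and the value at the top corner are squeezed between those of [A] and
    [B]; only 1-monotonicity needs [kC]. *)
Lemma standardized_between (R : realType) (n k : nat) (A B C : 'rV[R]_n -> R) :
  (1 <= k <= n)%N -> standardized A -> standardized B ->
  le_on_cube A C -> le_on_cube C B -> k_increasing k C -> standardized C.
Proof.
move=> kn [Au Ag _ A1] [Bu Bg _ B1] lAC lCB kC.
have gC : grounded C.
  move=> x xc x0; apply/eqP; rewrite eq_le; have := lAC x xc; have := lCB x xc.
  by rewrite Ag// Bg// => -> ->.
split=> //; last 2 first.
- exact: grounded_k_increasing1 kC.
- have c1 : cube (const_mx 1 : 'rV[R]_n) by move=> i; rewrite mxE ler01 lexx.
  apply/eqP; rewrite eq_le; have := lAC _ c1; have := lCB _ c1.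
  by rewrite A1 B1 => -> ->.
- move=> x xc; have /andP[A0 _] := Au x xc; have /andP[_ B1'] := Bu x xc.
  by rewrite (le_trans A0 (lAC x xc)) (le_trans (lCB x xc) B1').
Qed.

(** * Families with positive multiplicity at a point, and the infimum [PM] *)

Lemma exists_positive_mult (R : realType) (n k : nat) (x : 'rV[R]_n) :
  (k <= n)%N -> cube x -> (forall i, 0 < x ord0 i) ->
  exists2 F : seq (box R n), kfamily k F & 0 < mult k F x.
Proof.
move=> kn xc x0.
have [|J _ Jk] := @exists_subset _ [set: 'I_n]%SET k.
  by rewrite cardsT card_ord.
(* As [x] has positive coordinates, it meets the lower corner of [b] in exactly [n - k] of them, so
   its sign is [+1]. *)
pose b : box R n := (\row_i (if i \in J then 0 else x ord0 i), x).
have kb : is_kbox k b.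
  split=> //= [i|i|].
  - by rewrite mxE; case: ifP => // _; rewrite lexx ler01.
  - by rewrite mxE; case: ifP => // _; exact: ltW.
  - rewrite -Jk; apply: eq_card => i; rewrite inE mxE.
    by case: ifP => iJ; rewrite ?x0 ?iJ ?ltxx.
exists [:: b]; first by move=> b'; rewrite inE => /eqP ->.
rewrite mult_seq1 /box_mult asboolT; last by right.
rewrite /box_sign (_ : _ - _ = 0)%N ?expr0//.
have -> : [set i | x ord0 i == b.1 ord0 i]%SET = ~: J.
  apply/finset.setP => i; rewrite !inE mxE; case: ifP => iJ; rewrite ?eqxx//.
  by rewrite gt_eqF.
by rewrite cardsCs finset.setCK card_ord Jk subnn.
Qed.

(** Clears the denominators and absorbs the convention on the empty infimum: in that case [x] has a
    zero coordinate, so [B x - A x] equals the default value 0. *)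
Lemma PM_ge (R : realType) (n k : nat) (A B : 'rV[R]_n -> R) (x : 'rV[R]_n) :
  (k <= n)%N -> grounded A -> grounded B -> cube x ->
  ((B x - A x)%:E <= PM k A B x)%E <->
  (forall F : seq (box R n), kfamily k F -> 0 < mult k F x ->
     (mult k F x)%:~R * (B x - A x) <= Lk k A B F).
Proof.
move=> kn Ag Bg xc; rewrite /PM; set E := [set _ | _ in _].
have quotE F : 0 < mult k F x ->
    ((mult k F x)%:~R * (B x - A x) <= Lk k A B F) =
    ((B x - A x)%:E <= (Lk k A B F / `|mult k F x|%:~R)%:E)%E.
  by move=> m0; rewrite lee_fin gtr0_norm// ler_pdivlMr ?ltr0z// mulrC.
case: asboolP => [E0|/eqP/set0P EN0]; split.
- move=> _ F kF m0; suff: E (Lk k A B F / `|mult k F x|%:~R)%:E by rewrite E0.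
  by exists F.
- move=> _; have [[i xi]|xN0] := pselect (exists i, x ord0 i = 0).
    by rewrite Ag ?Bg ?subrr//; exists i.
  have [|F kF m0] := exists_positive_mult kn xc.
    move=> i; rewrite lt_neqAle; have /andP[-> _] := xc i; rewrite andbT.
    by apply/eqP => xi; apply: xN0; exists i.
  suff: E (Lk k A B F / `|mult k F x|%:~R)%:E by rewrite E0.
  by exists F.
- move=> PE F kF m0; rewrite quotE//; apply: (le_trans PE).
  by apply: ereal_inf_lbound; exists F.
- by move=> H; apply: le_ereal_inf_tmp => _ [F [kF m0] <-]; rewrite -quotE// H.
Qed.

(** * Equivalence of the bound on [PM] with the formula for [A] as an infimum *)

Theorem theorem8p3 (R : realType) (n k : nat) (A B : 'rV[R]_n -> R)
    (hn : (0 < n)%N) (hk : (1 <= k <= n)%N)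
    (hA : standardized A) (hB : standardized B) (hAB : le_on_cube A B)
    (hS : condition_S A \/ condition_S B)
    (hL : forall F : seq (box R n), kfamily k F -> 0 <= Lk k A B F) :
  (forall x : 'rV[R]_n, cube x -> ((B x - A x)%:E <= PM k A B x)%E)
  <->
  (forall x : 'rV[R]_n, cube x ->
    (A x)%:E = ereal_inf [set (C x)%:E
      | C in [set C : 'rV[R]_n -> R |
          [/\ le_on_cube A C, le_on_cube C B,
              k_increasing k C & standardized C]]]).
Proof.
have [_ Ag _ _] := hA; have [_ Bg _ _] := hB; have /andP[_ kn] := hk.
split=> [hP x xc|hinf x xc].
  apply/eqP; rewrite eq_le; apply/andP; split.
    by apply: le_ereal_inf_tmp => _ [C [lAC _ _ _] <-]; rewrite lee_fin lAC.
  pose B' : 'rV[R]_n -> R := [eta B with x |-> A x].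
  have AB' : le_on_cube A B'.
    by move=> y /hAB AyBy; rewrite /B' /=; case: eqVneq => [->|_].
  have [F kF|C [lAC lCB' kC]] := @k_increasing_between _ _ k _ _ AB'.
    have mf := mult_finite k F.
    have := hL F kF; have /(PM_ge kn Ag Bg xc)/(_ F kF) := hP x xc.
    rewrite (LkE hAB kF).
    have := max_sum_update A B x (A x) (B x) mf.
    have := max_sum_update A B x (A x) (A x) mf.
    rewrite !update_self max_val_cst max_valE ?hAB// => -> ->.
    (* For [mult k F x <= 0] the maximum at [x] already uses [A x], so lowering [B x] changes
       nothing and [hL] suffices; for positive multiplicity the loss is exactly the quantity bounded
       by [PM_ge]. *)
    case: ltP => // _ /(_ isT) + _.
    by rewrite mulrBr lerBlDr -addrA lerDl addrC.
  have lCB : le_on_cube C B.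
    move=> y yc; apply: (le_trans (lCB' y yc)); rewrite /B' /=.
    by case: eqVneq => [->|//]; exact: hAB.
  apply: ereal_inf_lbound; exists C.
    by split=> //; exact: (standardized_between hk hA hB).
  congr _%:E; apply/eqP; rewrite eq_le lAC// andbT.
  by have := lCB' x xc; rewrite /B' /= eqxx.
apply/PM_ge => // F kF m0; have mR : 0 < (mult k F x)%:~R :> R by rewrite ltr0z.
have mf := mult_finite k F.
(* Solved for [A x], the goal says that [B x - Lk k A B F / mult k F x] is a lower bound of the
   infimum, which is checked for each [C]. *)
rewrite mulrC -ler_pdivlMr// lerBlDl -lerBlDr -lee_fin hinf//.
apply: le_ereal_inf_tmp => _ [C [lAC lCB kC _] <-].
rewrite lee_fin lerBlDr -lerBlDl ler_pdivlMr// mulrC (LkE hAB kF).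
(* On the cube [C'] still lies between [A] and [B]; raising [C] at [x] adds
   [mult k F x * (B x - C x)] to the nonnegative sum of [C]. *)
pose C' : 'rV[R]_n -> R := [eta C with x |-> B x].
apply: (@le_trans _ _ (max_sum C' C' (mult k F))); last first.
  apply: max_sum_cst_le => // y /(mult_cube kF) yc; rewrite /C' /=.
  by case: eqVneq => [->|_]; rewrite ?hAB ?lexx ?lAC ?lCB.
have := k_increasing_mult kC kF.
have := max_sum_update C C x (C x) (C x) mf.
rewrite !update_self max_val_cst => -> C0.
by rewrite max_sum_update// max_val_cst mulrBr lerBlDr -addrA lerDl addrC.
Qed.
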